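(* Let $\mathbb{T}$ be a pointed algebraic theory, with constant $0$, which contains among its binary operations two operations $+$ and $-$ satisfying the axioms $$x+0=x,\qquad 0+x=x,\qquad (x+y)-y=x,\qquad (x-y)+y=x.$$ Let $B$ be an object of $\mathbf{Top}^{\mathbb{T}}$ and let $(X,\xi)$ be an algebra over the monad $\mathbf{T}^B$ on $\mathbf{Top}^{\mathbb{T}}$. Then the semidirect product $(X,\xi)\rtimes B$ in $\mathbf{Top}^{\mathbb{T}}$ is (up to isomorphism) the topological space $X\times B$ (with the product topology) equipped with the $\mathbb{T}$-algebra structure given, for every operation $\omega\in\Omega$ (of arity $n$) and all $x_1,\dots,x_n\in X$, $b_1,\dots,b_n\in B$, by $$\omega\big((x_1,b_1),\ldots,(x_n,b_n)\big)=\Big(\xi\big(\omega(x_1+b_1,\ldots,x_n+b_n)-\omega(b_1,\ldots,b_n)\big),\ \omega(b_1,\ldots,b_n)\Big).$$ Here the expression $\omega(x_1+b_1,\ldots,x_n+b_n)-\omega(b_1,\ldots,b_n)$ is computed in the coproduct $X+B$ of $\mathbf{Top}^{\mathbb{T}}$ and is an element of $B\flat X\subseteq X+B$.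
   Context: An algebraic theory $\mathbb{T}=(\Omega,V,E)$ consists of a set $\Omega$ of finitary operation symbols, variables $V$ and a set $E$ of equations between terms. $\mathbf{Set}^{\mathbb{T}}$ is the category of $\mathbb{T}$-algebras and homomorphisms; $\mathbf{Top}^{\mathbb{T}}$ is the category of topological $\mathbb{T}$-algebras (topological spaces equipped with continuous operations $\omega\colon A^{n}\to A$ for each $n$-ary $\omega\in\Omega$ satisfying $E$) and continuous homomorphisms. A theory is pointed with constant $0$ if it has exactly one constant, i.e. every constant term is equal to $0$ in the theory; then $\mathbf{Top}^{\mathbb{T}}$ has a zero object, and the kernel $K[p]$ of a morphism $p$ is the subalgebra $p^{-1}(0)$ with the subspace topology. $\mathbf{Top}^{\mathbb{T}}$ is complete and cocomplete. For a category $\mathbf{C}$ and an object $B$, $\mathbf{Pt}_B(\mathbf{C})$ is the category of points over $B$: objects are pairs $(p\colon A\to B,\ s\colon B\to A)$ with $ps=1_B$; a morphism $(p,s)\to(p',s')$ is a morphism $f\colon A\to A'$ with $p'f=p$ and $fs=s'$. Let $\mathbf{C}$ be pointed, finitely complete and finitely cocomplete. The functor $U^B\colon\mathbf{Pt}_B(\mathbf{C})\to\mathbf{C}$, $(p,s)\mapsto K[p]$, has the left adjoint $F^B\colon X\mapsto([0,1]\colon X+B\to B,\ \iota_B\colon B\to X+B)$. The induced monad on $\mathbf{C}$ is $\mathbf{T}^B=(T^B,\eta,\mu)$, with $T^B=U^BF^B$, so that $T^B(X)=B\flat X:=K\big([0,1]\colon X+B\to B\big)$. A $\mathbf{T}^B$-algebra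 is an Eilenberg–Moore algebra $\xi\colon B\flat X\to X$. $\mathbf{C}$ has semidirect products if every $U^B$ is monadic, i.e. the comparison functor $J\colon\mathbf{Pt}_B(\mathbf{C})\to\mathbf{C}^{\mathbf{T}^B}$ is an equivalence; in that case the semidirect product $(X,\xi)\rtimes B$ is the point over $B$ corresponding to $(X,\xi)$ under this equivalence (its underlying object is the domain $A$ of that point). It is known that $\mathbf{Top}^{\mathbb{T}}$ has semidirect products whenever $\mathbb{T}$ is a semi-abelian theory (i.e. $\mathbf{Set}^{\mathbb{T}}$ is a semi-abelian category), which is the case for the theories in the claim. Elements of $X$ and $B$ are identified with their images in $X+B$ under the coproduct injections. *)

(* Defs.v *)
From HB Require Import structures.
From mathcomp Require Import all_boot finmap.
From mathcomp Require Import all_classical.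
From mathcomp Require Import topology.

Set Implicit Arguments.
Unset Strict Implicit.
Unset Printing Implicit Defensive.

Local Open Scope classical_set_scope.

Lemma sval_eq (T : Type) (P : T -> Prop) (x y : {t : T | P t}) :
  sval x = sval y -> x = y.
Proof. by case: x y => [x Px] [y Py] /= xy; exact: eq_exist. Qed.

Declare Scope cat_scope.
Local Open Scope cat_scope.

Record category := Category {
  obj :> Type;
  hom : obj -> obj -> Type;
  idm : forall a, hom a a;
  compm : forall a b c, hom b c -> hom a b -> hom a c;
  compm1 : forall a b (f : hom a b), compm f (idm a) = f;
  comp1m : forall a b (f : hom a b), compm (idm b) f = f;
  compmA : forall a b c d (h : hom c d) (g : hom b c) (f : hom a b),
    compm h (compm g f) = compm (compm h g) f }.

Arguments idm {c} a : rename.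
Notation "g ∘ f" := (compm g f) (at level 40, left associativity) : cat_scope.

Definition is_iso (C : category) (a b : C) (f : hom a b) : Prop :=
  exists g : hom b a, g ∘ f = idm a /\ f ∘ g = idm b.

Definition isomorphic (C : category) (a b : C) : Prop :=
  exists f : hom a b, is_iso f.

Record functor (C D : category) := Functor {
  fob :> C -> D;
  fmap : forall a b, hom a b -> hom (fob a) (fob b);
  fmap1 : forall a, fmap (idm a) = idm (fob a);
  fmapM : forall a b c (g : hom b c) (f : hom a b),
    fmap (g ∘ f) = fmap g ∘ fmap f }.

Definition id_functor (C : category) : functor C C :=
  @Functor C C id (fun _ _ f => f) (fun=> erefl) (fun _ _ _ _ _ => erefl).

Section CompFunctor.
Variables (C D E : category) (G : functor D E) (F : functor C D).

Lemma comp_fmap1 a : fmap G (fmap F (idm a)) = idm (G (F a)).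
Proof. by rewrite !fmap1. Qed.

Lemma comp_fmapM a b c (g : hom b c) (f : hom a b) :
  fmap G (fmap F (g ∘ f)) = fmap G (fmap F g) ∘ fmap G (fmap F f).
Proof. by rewrite !fmapM. Qed.

Definition comp_functor : functor C E :=
  @Functor C E (fun a => G (F a)) (fun _ _ f => fmap G (fmap F f))
    comp_fmap1 comp_fmapM.

End CompFunctor.

Definition natural (C D : category) (F G : functor C D)
    (t : forall a, hom (F a) (G a)) : Prop :=
  forall a b (f : hom a b), t b ∘ fmap F f = fmap G f ∘ t a.

Definition naturally_isomorphic (C D : category) (F G : functor C D) : Prop :=
  exists t : forall a, hom (F a) (G a), natural t /\ forall a, is_iso (t a).

Definition quasi_inverse (C D : category) (F : functor C D) (G : functor D C) :=
  naturally_isomorphic (comp_functor G F) (id_functor C) /\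
  naturally_isomorphic (comp_functor F G) (id_functor D).

Definition is_equivalence (C D : category) (F : functor C D) : Prop :=
  exists G : functor D C, quasi_inverse F G.

Record monad (C : category) := Monad {
  mfun :> functor C C;
  munit : forall a, hom a (mfun a);
  mmult : forall a, hom (mfun (mfun a)) (mfun a);
  munit_nat : @natural C C (id_functor C) mfun munit;
  mmult_nat : @natural C C (comp_functor mfun mfun) mfun mmult;
  mmultA : forall a, mmult a ∘ fmap mfun (mmult a) = mmult a ∘ mmult (mfun a);
  munitl : forall a, mmult a ∘ munit (mfun a) = idm (mfun a);
  munitr : forall a, mmult a ∘ fmap mfun (munit a) = idm (mfun a) }.

(* The Eilenberg-Moore category of a monad. *)
Section EilenbergMoore.
Variables (C : category) (M : monad C).

Definition is_em_algebra (X : C) (xi : hom (M X) X) : Prop :=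
  xi ∘ munit M X = idm X /\ xi ∘ mmult M X = xi ∘ fmap M xi.

Record em_algebra := EMAlgebra {
  em_carrier : C;
  em_action : hom (M em_carrier) em_carrier;
  em_actionP : is_em_algebra em_action }.

Definition em_hom (X Y : em_algebra) :=
  {f : hom (em_carrier X) (em_carrier Y) |
    f ∘ em_action X = em_action Y ∘ fmap M f}.

Lemma em_id_subproof (X : em_algebra) :
  idm _ ∘ em_action X = em_action X ∘ fmap M (idm _).
Proof. by rewrite fmap1 comp1m compm1. Qed.

Definition em_id (X : em_algebra) : em_hom X X := exist _ _ (em_id_subproof X).

Lemma em_comp_subproof (X Y Z : em_algebra) (g : em_hom Y Z) (f : em_hom X Y) :
  (sval g ∘ sval f) ∘ em_action X = em_action Z ∘ fmap M (sval g ∘ sval f).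
Proof.
by case: g f => [g gP] [f fP]; rewrite /= -compmA fP fmapM compmA gP compmA.
Qed.

Definition em_comp (X Y Z : em_algebra) (g : em_hom Y Z) (f : em_hom X Y) :
  em_hom X Z := exist _ _ (em_comp_subproof g f).

Lemma em_compm1 X Y (f : em_hom X Y) : em_comp f (em_id X) = f.
Proof. by apply: sval_eq; rewrite /= compm1. Qed.

Lemma em_comp1m X Y (f : em_hom X Y) : em_comp (em_id Y) f = f.
Proof. by apply: sval_eq; rewrite /= comp1m. Qed.

Lemma em_compmA X Y Z W (h : em_hom Z W) (g : em_hom Y Z) (f : em_hom X Y) :
  em_comp h (em_comp g f) = em_comp (em_comp h g) f.
Proof. by apply: sval_eq; rewrite /= compmA. Qed.

Definition em_category : category :=
  @Category em_algebra em_hom em_id em_comp em_compm1 em_comp1m em_compmA.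

End EilenbergMoore.

(* [adjunction F U] : F is left adjoint to U. *)
Record adjunction (C D : category) (F : functor C D) (U : functor D C) :=
  Adjunction {
  adj_unit : forall a, hom a (U (F a));
  adj_counit : forall b, hom (F (U b)) b;
  adj_unit_nat : @natural C C (id_functor C) (comp_functor U F) adj_unit;
  adj_counit_nat : @natural D D (comp_functor F U) (id_functor D) adj_counit;
  adj_triangleF : forall a, adj_counit (F a) ∘ fmap F (adj_unit a) = idm (F a);
  adj_triangleU : forall b, fmap U (adj_counit b) ∘ adj_unit (U b) = idm (U b) }.

Section AdjunctionMonad.
Variables (C D : category) (F : functor C D) (U : functor D C).
Variable adj : adjunction F U.

Let mu a : hom (U (F (U (F a)))) (U (F a)) := fmap U (adj_counit adj (F a)).

Lemma adj_mmult_nat : @natural C C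
  (comp_functor (comp_functor U F) (comp_functor U F)) (comp_functor U F) mu.
Proof.
move=> a b f; rewrite /= /mu -!fmapM; congr (fmap U _).
exact: (adj_counit_nat adj (fmap F f)).
Qed.

Lemma adj_mmultA a : mu a ∘ fmap U (fmap F (mu a)) = mu a ∘ mu (U (F a)).
Proof.
rewrite /mu -!fmapM; congr (fmap U _).
exact: (adj_counit_nat adj (adj_counit adj (F a))).
Qed.

Lemma adj_munitl a : mu a ∘ adj_unit adj (U (F a)) = idm (U (F a)).
Proof. exact: adj_triangleU. Qed.

Lemma adj_munitr a : mu a ∘ fmap U (fmap F (adj_unit adj a)) = idm (U (F a)).
Proof. by rewrite /mu -fmapM adj_triangleF fmap1. Qed.

Definition adj_monad : monad C :=
  @Monad C (comp_functor U F) (adj_unit adj) mu (adj_unit_nat adj)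
    adj_mmult_nat adj_mmultA adj_munitl adj_munitr.

Lemma comparison_em_algebra (b : D) :
  is_em_algebra (M := adj_monad) (fmap U (adj_counit adj b)).
Proof.
split; first exact: adj_triangleU.
rewrite /= /mu -!fmapM; congr (fmap U _).
exact: (esym (adj_counit_nat adj (adj_counit adj b))).
Qed.

Lemma comparison_em_hom (b c : D) (f : hom b c) :
  fmap U f ∘ fmap U (adj_counit adj b) =
  fmap U (adj_counit adj c) ∘ fmap U (fmap F (fmap U f)).
Proof.
by rewrite -!fmapM; congr (fmap U _); exact: (esym (adj_counit_nat adj f)).
Qed.

Let J_ob (b : D) : em_category adj_monad :=
  EMAlgebra (comparison_em_algebra b).

Let J_map (b c : D) (f : hom b c) : hom (J_ob b) (J_ob c) :=
  exist _ (fmap U f) (comparison_em_hom f).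

Lemma comparison_fmap1 b : J_map (idm b) = idm (J_ob b).
Proof. by apply: sval_eq; exact: fmap1. Qed.

Lemma comparison_fmapM a b c (g : hom b c) (f : hom a b) :
  J_map (g ∘ f) = J_map g ∘ J_map f.
Proof. by apply: sval_eq; exact: fmapM. Qed.

Definition comparison : functor D (em_category adj_monad) :=
  Functor comparison_fmap1 comparison_fmapM.

End AdjunctionMonad.

(* A pointed category with chosen kernels and binary coproducts: of finite
   completeness and cocompleteness, this is all that enters the definition of
   the monads T^B. *)
Record pointed_category := PointedCategory {
  base_cat :> category;
  zob : base_cat;
  to_zob : forall a, hom a zob;
  of_zob : forall a, hom zob a;
  to_zob_uniq : forall a (f : hom a zob), f = to_zob a;
  of_zob_uniq : forall a (f : hom zob a), f = of_zob a;
  zerom := (fun a b => of_zob b ∘ to_zob a) : forall a b, hom a b;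
  ker : forall a b (p : hom a b), base_cat;
  ker_in : forall a b (p : hom a b), hom (ker p) a;
  ker_inE : forall a b (p : hom a b), p ∘ ker_in p = zerom (ker p) b;
  ker_lift : forall a b (p : hom a b) x (f : hom x a),
    p ∘ f = zerom x b -> hom x (ker p);
  ker_liftE : forall a b (p : hom a b) x (f : hom x a) (pf0 : p ∘ f = zerom x b),
    ker_in p ∘ ker_lift pf0 = f;
  ker_in_mono : forall a b (p : hom a b) x (f g : hom x (ker p)),
    ker_in p ∘ f = ker_in p ∘ g -> f = g;
  coprod : base_cat -> base_cat -> base_cat;
  inj1 : forall a b, hom a (coprod a b);
  inj2 : forall a b, hom b (coprod a b);
  copair : forall a b c, hom a c -> hom b c -> hom (coprod a b) c;
  copair1 : forall a b c (f : hom a c) (g : hom b c),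
    copair f g ∘ inj1 a b = f;
  copair2 : forall a b c (f : hom a c) (g : hom b c),
    copair f g ∘ inj2 a b = g;
  copair_uniq : forall a b c (h k : hom (coprod a b) c),
    h ∘ inj1 a b = k ∘ inj1 a b -> h ∘ inj2 a b = k ∘ inj2 a b -> h = k }.

Arguments inj1 {p} a b : rename.
Arguments inj2 {p} a b : rename.
Arguments zerom {p} a b : rename.

Section Points.
Variables (C : pointed_category) (B : C).

Lemma zerom_comp (a b c : C) (f : hom a b) : zerom b c ∘ f = zerom a c.
Proof. by rewrite /zerom -compmA (to_zob_uniq (_ ∘ f)). Qed.

Lemma comp_zerom (a b c : C) (f : hom b c) : f ∘ zerom a b = zerom a c.
Proof. by rewrite /zerom compmA (of_zob_uniq (f ∘ _)). Qed.

Record point := Point {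
  pdom : C;
  pproj : hom pdom B;
  psect : hom B pdom;
  psectK : pproj ∘ psect = idm B }.

Definition point_hom (P Q : point) :=
  {f : hom (pdom P) (pdom Q) | pproj Q ∘ f = pproj P /\ f ∘ psect P = psect Q}.

Definition point_id (P : point) : point_hom P P :=
  exist _ (idm (pdom P)) (conj (compm1 _) (comp1m _)).

Lemma point_comp_subproof (P Q R : point) (g : point_hom Q R) (f : point_hom P Q) :
  pproj R ∘ (sval g ∘ sval f) = pproj P /\ (sval g ∘ sval f) ∘ psect P = psect R.
Proof.
case: g f => [g [g1 g2]] [f [f1 f2]] /=.
by rewrite compmA g1 f1 -compmA f2 g2.
Qed.

Definition point_comp (P Q R : point) (g : point_hom Q R) (f : point_hom P Q) :
  point_hom P R := exist _ _ (point_comp_subproof g f).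

Lemma point_compm1 P Q (f : point_hom P Q) : point_comp f (point_id P) = f.
Proof. by apply: sval_eq; rewrite /= compm1. Qed.

Lemma point_comp1m P Q (f : point_hom P Q) : point_comp (point_id Q) f = f.
Proof. by apply: sval_eq; rewrite /= comp1m. Qed.

Lemma point_compmA P Q R S
    (h : point_hom R S) (g : point_hom Q R) (f : point_hom P Q) :
  point_comp h (point_comp g f) = point_comp (point_comp h g) f.
Proof. by apply: sval_eq; rewrite /= compmA. Qed.

Definition Pt : category :=
  @Category point point_hom point_id point_comp
    point_compm1 point_comp1m point_compmA.

Lemma U_map_subproof (P Q : Pt) (f : hom P Q) :
  pproj Q ∘ (sval f ∘ ker_in (pproj P)) = zerom (ker (pproj P)) B.
Proof. by case: f => f [f1 f2] /=; rewrite compmA f1 ker_inE. Qed.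

Definition U_map (P Q : Pt) (f : hom P Q) :
  hom (ker (pproj P)) (ker (pproj Q)) := ker_lift (U_map_subproof f).

Lemma U_map1 (P : Pt) : U_map (idm P) = idm (ker (pproj P)).
Proof. by apply: ker_in_mono; rewrite ker_liftE /= comp1m compm1. Qed.

Lemma U_mapM (P Q R : Pt) (g : hom Q R) (f : hom P Q) :
  U_map (g ∘ f) = U_map g ∘ U_map f.
Proof.
apply: ker_in_mono; rewrite ker_liftE /= compmA ker_liftE -compmA.
by rewrite -[RHS]compmA ker_liftE.
Qed.

Definition U_functor : functor Pt C :=
  @Functor Pt C (fun P => ker (pproj P)) U_map U_map1 U_mapM.

Definition F_ob (X : C) : Pt :=
  Point (copair2 (zerom X B) (idm B)).

Lemma F_map_subproof (X Y : C) (f : hom X Y) :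
  let g := copair (inj1 Y B ∘ f) (inj2 Y B) in
  pproj (F_ob Y) ∘ g = pproj (F_ob X) /\ g ∘ psect (F_ob X) = psect (F_ob Y).
Proof.
move=> g; split; last by rewrite /= copair2.
apply: copair_uniq; rewrite -compmA ?copair1 ?copair2 //=.
by rewrite compmA copair1 zerom_comp.
Qed.

Definition F_map (X Y : C) (f : hom X Y) : hom (F_ob X) (F_ob Y) :=
  exist _ _ (F_map_subproof f).

Lemma F_map1 (X : C) : F_map (idm X) = idm (F_ob X).
Proof.
apply: sval_eq; apply: copair_uniq => /=.
  by rewrite copair1 compm1 comp1m.
by rewrite copair2 comp1m.
Qed.

Lemma F_mapM (X Y Z : C) (g : hom Y Z) (f : hom X Y) :
  F_map (g ∘ f) = F_map g ∘ F_map f.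
Proof.
apply: sval_eq; apply: copair_uniq => /=.
  by rewrite -[RHS]compmA !copair1 !compmA copair1.
by rewrite -[RHS]compmA !copair2.
Qed.

Definition F_functor : functor C Pt :=
  @Functor C Pt F_ob F_map F_map1 F_mapM.

Definition FU_unit (X : C) : hom X (U_functor (F_functor X)) :=
  ker_lift (copair1 (zerom X B) (idm B)).

Lemma FU_counit_subproof (P : Pt) :
  let g := copair (ker_in (pproj P)) (psect P) in
  pproj P ∘ g = pproj (F_ob (ker (pproj P))) /\
  g ∘ psect (F_ob (ker (pproj P))) = psect P.
Proof.
move=> g; split; last by rewrite /= copair2.
apply: copair_uniq; rewrite -compmA ?copair1 ?copair2 //=.
  exact: ker_inE.
exact: psectK.
Qed.

Definition FU_counit (P : Pt) : hom (F_functor (U_functor P)) P :=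
  exist _ _ (FU_counit_subproof P).

Lemma FU_unit_nat :
  @natural C C (id_functor C) (comp_functor U_functor F_functor) FU_unit.
Proof.
move=> X Y f; apply: ker_in_mono.
rewrite /= compmA ker_liftE [RHS]compmA ker_liftE /=.
by rewrite -[RHS]compmA ker_liftE copair1.
Qed.

Lemma FU_counit_nat :
  @natural Pt Pt (comp_functor F_functor U_functor) (id_functor Pt) FU_counit.
Proof.
move=> P Q f; apply: sval_eq; apply: copair_uniq => /=; rewrite -[LHS]compmA -[RHS]compmA.
  by rewrite !copair1 compmA copair1 ker_liftE.
by rewrite !copair2; case: f => f [f1 f2].
Qed.

Lemma FU_triangleF (X : C) :
  FU_counit (F_functor X) ∘ fmap F_functor (FU_unit X) = idm (F_functor X).
Proof.
apply: sval_eq; apply: copair_uniq => /=; rewrite -compmA ?copair1 ?copair2.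
  by rewrite compmA copair1 ker_liftE comp1m.
by rewrite comp1m.
Qed.

Lemma FU_triangleU (P : Pt) :
  fmap U_functor (FU_counit P) ∘ FU_unit (U_functor P) = idm (U_functor P).
Proof.
apply: ker_in_mono; rewrite compmA ker_liftE -compmA ker_liftE /= copair1.
by rewrite compm1.
Qed.

Definition FU_adjunction : adjunction F_functor U_functor :=
  Adjunction FU_unit_nat FU_counit_nat FU_triangleF FU_triangleU.

Definition T_monad : monad C := adj_monad FU_adjunction.

Definition J_functor : functor Pt (em_category T_monad) :=
  comparison FU_adjunction.

(* B ♭ X and its inclusion into X + B *)
Definition flat (X : C) : C := T_monad X.

Definition flat_in (X : C) : hom (flat X) (coprod X B) :=
  ker_in (copair (zerom X B) (idm B)).

End Points.

(* P is, up to isomorphism in Pt_B(C), the semidirect product (X, xi) ⋊ B: the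
   comparison functor is an equivalence, and P is the image of (X, xi) under a
   quasi-inverse of it (any two quasi-inverses agree up to isomorphism). *)
Definition is_semidirect_product (C : pointed_category) (B : C)
    (Xxi : em_category (T_monad B)) (P : Pt B) : Prop :=
  exists G : functor (em_category (T_monad B)) (Pt B),
    quasi_inverse (J_functor B) G /\ isomorphic (G Xxi) P.

Record signature := Signature { opsym :> Type; arity : opsym -> nat }.

Inductive term (S : signature) (W : Type) : Type :=
| Var of W
| Op (o : S) of ('I_(arity o) -> term S W).

Arguments Var {S W} _.
Arguments Op {S W} o _.

Fixpoint eval (S : signature) (A : Type)
    (op : forall o : S, ('I_(arity o) -> A) -> A)
    (W : Type) (v : W -> A) (t : term S W) {struct t} : A :=
  match t with
  | Var w => v w
  | Op o ts => op o (fun i => eval op v (ts i))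
  end.

Record theory := Theory {
  sig :> signature;
  tvar : Type;
  teqn : term sig tvar -> term sig tvar -> Prop }.

(* Equality of terms in the theory: derivability in equational logic. *)
Inductive provable (T : theory) (W : Type) : term T W -> term T W -> Prop :=
| provable_eqn (l r : term T (tvar T)) (s : tvar T -> term T W) :
    teqn l r -> provable (eval (@Op T W) s l) (eval (@Op T W) s r)
| provable_refl t : provable t t
| provable_sym t u : provable t u -> provable u t
| provable_trans t u w : provable t u -> provable u w -> provable t w
| provable_congr (o : T) (ts us : 'I_(arity o) -> term T W) :
    (forall i, provable (ts i) (us i)) -> provable (Op o ts) (Op o us).

(* Constant terms are the terms without variables; all of them equal 0. *)
Record pointed_theory := PointedTheory {
  ptheory :> theory;
  zero_term : term ptheory void;
  zero_termP : forall t : term ptheory void, provable t zero_term }.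

Definition zero_of (T : pointed_theory) (A : Type)
    (op : forall o : T, ('I_(arity o) -> A) -> A) : A :=
  eval op (of_void A) (zero_term T).

(* The binary operation interpreting a term in two variables. *)
Definition binop (S : signature) (t : term S 'I_2) (A : Type)
    (op : forall o : S, ('I_(arity o) -> A) -> A) (a b : A) : A :=
  eval op (fun i : 'I_2 => if i == ord0 then a else b) t.

Section TopAlgebra.
Variable T : theory.

(* The finite power A^n carries the product topology {ptws 'I_n -> A}. *)
Record is_top_algebra (A : topologicalType)
    (op : forall o : T, ('I_(arity o) -> A) -> A) : Prop := IsTopAlgebra {
  op_continuous : forall o,
    continuous (op o : {ptws 'I_(arity o) -> A} -> A);
  op_eqn : forall l r (v : tvar T -> A), teqn l r -> eval op v l = eval op v r }.

Record top_algebra := TopAlgebra {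
  carrier :> topologicalType;
  interp : forall o : T, ('I_(arity o) -> carrier) -> carrier;
  interpP : is_top_algebra interp }.

Definition is_top_hom (A B : top_algebra) (f : A -> B) : Prop :=
  continuous f /\
  forall (o : T) (a : 'I_(arity o) -> A),
    f (interp a) = interp (fun i => f (a i)).

Record top_hom (A B : top_algebra) := TopHom {
  thfun :> A -> B;
  thfunP : is_top_hom thfun }.

End TopAlgebra.

Arguments interp {T t} o _ : rename.

Section TopCategory.
Variable T : theory.
Implicit Types A B C D : top_algebra T.

Lemma top_hom_eq A B (f g : top_hom A B) : (forall a, f a = g a) -> f = g.
Proof.
case: f g => [f fP] [g gP] /= fg; have {}fg : f = g by exact/funext.
by subst g; rewrite (Prop_irrelevance fP gP).
Qed.

Lemma top_id_subproof A : is_top_hom (fun a : A => a).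
Proof. by split=> // x; exact: cvg_id. Qed.

Definition top_id A : top_hom A A := TopHom (@top_id_subproof A).

Lemma top_comp_subproof A B C (g : top_hom B C) (f : top_hom A B) :
  is_top_hom (fun a => g (f a)).
Proof.
case: g f => [g [gc gm]] [f [fc fm]]; split => /=.
  by move=> x; apply: continuous_comp; [exact: fc|exact: gc].
by move=> o a; rewrite fm gm.
Qed.

Definition top_comp A B C (g : top_hom B C) (f : top_hom A B) : top_hom A C :=
  TopHom (top_comp_subproof g f).

Lemma top_compm1 A B (f : top_hom A B) : top_comp f (top_id A) = f.
Proof. exact: top_hom_eq. Qed.

Lemma top_comp1m A B (f : top_hom A B) : top_comp (top_id B) f = f.
Proof. exact: top_hom_eq. Qed.

Lemma top_compmA A B C D
    (h : top_hom C D) (g : top_hom B C) (f : top_hom A B) :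
  top_comp h (top_comp g f) = top_comp (top_comp h g) f.
Proof. exact: top_hom_eq. Qed.

Definition Top : category :=
  @Category (top_algebra T) (@top_hom T) top_id top_comp
    top_compm1 top_comp1m top_compmA.

End TopCategory.

Lemma eval_hom (S : signature) (A B : Type)
    (opA : forall o : S, ('I_(arity o) -> A) -> A)
    (opB : forall o : S, ('I_(arity o) -> B) -> B) (f : A -> B) :
  (forall o a, f (opA o a) = opB o (fun i => f (a i))) ->
  forall W (v : W -> A) t, f (eval opA v t) = eval opB (fun w => f (v w)) t.
Proof.
move=> fm W v; elim => [//|o ts IH] /=.
by rewrite fm; congr (opB _ _); apply: funext => i; exact: IH.
Qed.

Lemma provable_sound (T : theory) (A : top_algebra T) W (v : W -> A) t u :
  provable t u -> eval (@interp T A) v t = eval (@interp T A) v u.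
Proof.
elim => {t u} [l r s lr|//|t u _ ->//|t u w _ -> _ ->//|o ts us _ IH] /=.
  by rewrite !(eval_hom (opB := @interp T A)) //; exact: (op_eqn (interpP A)).
by congr interp; apply: funext.
Qed.

Lemma ptws_continuous (S A : topologicalType) (n : nat)
    (f : S -> {ptws 'I_n -> A}) :
  (forall i, continuous (fun x => f x i)) -> continuous f.
Proof.
move=> fc x; apply/cvg_sup => i U [_ [[O oO <-] /= Ofx] sOU].
apply: filterS sOU _; apply: (fc i x); exact: open_nbhs_nbhs.
Qed.

Lemma ptws_proj_continuous (A : topologicalType) (n : nat) (i : 'I_n) :
  continuous (fun f : {ptws 'I_n -> A} => f i).
Proof. exact: (@proj_continuous _ (fun=> A) i). Qed.

Lemma ptws_map_continuous (A B : topologicalType) (n : nat) (f : A -> B) :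
  continuous f ->
  continuous ((fun a i => f (a i)) : {ptws 'I_n -> A} -> {ptws 'I_n -> B}).
Proof.
move=> fc; apply: ptws_continuous => i a.
apply: (@continuous_comp {ptws 'I_n -> A} A B (fun a => a i) f).
  exact: ptws_proj_continuous.
exact: fc.
Qed.

Lemma initial_continuousP (S W A : topologicalType) (g : W -> A)
    (f : S -> initial_topology g) :
  continuous (fun x => g (f x)) -> continuous f.
Proof.
move=> gc x U [_ [[O oO <-] /= Ofx] sOU].
apply: filterS sOU _; apply: (gc x); exact: open_nbhs_nbhs.
Qed.

Section ZeroAlgebra.
Variable T : theory.

(* unit with its only topology *)
Definition unit_space : topologicalType := initial_topology (fun _ : unit => true).

Lemma zero_algebraP : is_top_algebra
  (fun (o : T) (_ : 'I_(arity o) -> unit_space) => tt : unit_space).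
Proof.
split=> [o|l r v _]; first exact: cst_continuous.
by case: (eval _ _ l); case: (eval _ _ r).
Qed.

Definition zero_algebra : top_algebra T := TopAlgebra zero_algebraP.

Lemma to_zero_algebraP (A : top_algebra T) :
  is_top_hom (fun _ : A => tt : zero_algebra).
Proof. by split=> //; exact: cst_continuous. Qed.

Definition to_zero_algebra (A : top_algebra T) : top_hom A zero_algebra :=
  TopHom (to_zero_algebraP A).

Lemma to_zero_algebra_uniq (A : top_algebra T) (f : top_hom A zero_algebra) :
  f = to_zero_algebra A.
Proof. by apply: top_hom_eq => a; case: (f a). Qed.

End ZeroAlgebra.

Section Kernel.
Variable T : pointed_theory.
Implicit Types A B C : top_algebra T.

Definition zero_elt A : A := zero_of (@interp T A).

Lemma top_hom_zero A B (f : top_hom A B) : f (zero_elt A) = zero_elt B.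
Proof.
case: f => f [fc fm]; rewrite /= /zero_elt /zero_of (eval_hom (opB := @interp T B)) //.
by congr eval; apply: funext; case.
Qed.

Lemma interp_zero A (o : T) : interp o (fun=> zero_elt A) = zero_elt A.
Proof.
have /(provable_sound (of_void A)) /= := zero_termP (Op o (fun=> zero_term T)).
exact.
Qed.

Lemma of_zero_algebraP A : is_top_hom (fun _ : zero_algebra T => zero_elt A).
Proof.
by split=> [|o a]; [exact: cst_continuous|rewrite interp_zero].
Qed.

Definition of_zero_algebra A : top_hom (zero_algebra T) A :=
  TopHom (of_zero_algebraP A).

Lemma of_zero_algebra_uniq A (f : top_hom (zero_algebra T) A) :
  f = of_zero_algebra A.
Proof.
apply: top_hom_eq => -[] /=; rewrite -(top_hom_zero f).
by congr (f _); case: (zero_elt _).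
Qed.

Variables (A B : top_algebra T) (p : top_hom A B).

Definition ker_set : set A := [set a | p a = zero_elt B].

(* p^{-1}(0) with the subspace topology *)
Definition ker_space : topologicalType := set_type ker_set.

Lemma ker_interp_subproof (o : T) (a : 'I_(arity o) -> ker_space) :
  interp o (fun i => set_val (a i)) \in ker_set.
Proof.
apply/mem_set; have [_ fm] := thfunP p; rewrite /ker_set /= fm.
transitivity (interp o (fun=> zero_elt B)); last exact: interp_zero.
by congr interp; apply: funext => i; exact: (set_mem (valP (a i))).
Qed.

Definition ker_interp (o : T) (a : 'I_(arity o) -> ker_space) : ker_space :=
  exist (fun x => x \in ker_set) _ (ker_interp_subproof a).

Lemma ker_algebraP : is_top_algebra ker_interp.
Proof.
split=> [o|l r v lr].
  apply: (@initial_continuousP _ _ _ (set_val : ker_set -> A)) => a.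
  apply: (@continuous_comp {ptws 'I_(arity o) -> ker_space}
    {ptws 'I_(arity o) -> A} A (fun (a : 'I_(arity o) -> ker_space) i => set_val (a i))).
    by apply: ptws_map_continuous; exact: initial_continuous.
  exact: (op_continuous (interpP A)).
apply: val_inj; rewrite /= !(eval_hom (opB := @interp T A) (f := val)) //.
exact: (op_eqn (interpP A)).
Qed.

Definition ker_algebra : top_algebra T := TopAlgebra ker_algebraP.

Lemma ker_inclP : is_top_hom (fun a : ker_algebra => set_val a : A).
Proof. by split=> //; exact: initial_continuous. Qed.

Definition ker_incl : top_hom ker_algebra A := TopHom ker_inclP.

Lemma ker_inclE (a : ker_algebra) : p (ker_incl a) = zero_elt B.
Proof. exact: (set_mem (valP a)). Qed.

Lemma ker_incl_inj (a b : ker_algebra) : ker_incl a = ker_incl b -> a = b.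
Proof. exact: val_inj. Qed.

Lemma ker_factorP C (f : top_hom C A) (pf0 : forall c, p (f c) = zero_elt B) :
  is_top_hom (fun c : C => exist (fun x => x \in ker_set) (f c) (mem_set (pf0 c)) : ker_algebra).
Proof.
have [fc fm] := thfunP f; split=> [|o a].
  exact: (@initial_continuousP _ _ _ (set_val : ker_set -> A)).
by apply: val_inj; rewrite /= fm.
Qed.

Definition ker_factor C (f : top_hom C A) (pf0 : forall c, p (f c) = zero_elt B) :
  top_hom C ker_algebra := TopHom (ker_factorP pf0).

End Kernel.

Section Coproduct.
Variables (T : theory) (A B : top_algebra T).

Definition cocone_eval (C : top_algebra T) (f : top_hom A C) (g : top_hom B C)
  : term T (A + B)%type -> C :=
  eval (@interp T C) (fun w => match w with inl a => f a | inr b => g b end).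

(* The coproduct is realized as the image of the absolutely free algebra on
   A ⊔ B in the product of all cocones under A and B: two terms are identified
   when every cocone identifies them, and the topology is the initial one. *)
Definition coprod_equiv (t u : term T (A + B)%type) : Prop :=
  forall (C : top_algebra T) (f : top_hom A C) (g : top_hom B C),
    cocone_eval f g t = cocone_eval f g u.

Definition coprod_type : Type :=
  {classic {K : set (term T (A + B)%type) | exists t, K = coprod_equiv t}}.

HB.instance Definition _ := Choice.on coprod_type.

Definition coprod_class (t : term T (A + B)%type) : coprod_type :=
  exist _ (coprod_equiv t) (ex_intro _ t erefl).

Definition coprod_repr (q : coprod_type) : term T (A + B)%type :=
  sval (cid (svalP q)).

Definition coprod_ext (C : top_algebra T) (f : top_hom A C) (g : top_hom B C)
  (q : coprod_type) : C := cocone_eval f g (coprod_repr q).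

Lemma coprod_extE C (f : top_hom A C) (g : top_hom B C) t :
  coprod_ext f g (coprod_class t) = cocone_eval f g t.
Proof.
rewrite /coprod_ext /coprod_repr; case: cid => u /= tu.
by have : coprod_equiv u u by []; rewrite -{1}tu => ->.
Qed.

Lemma coprod_type_eq (q r : coprod_type) :
  (forall C (f : top_hom A C) (g : top_hom B C),
    coprod_ext f g q = coprod_ext f g r) -> q = r.
Proof.
move=> qr; apply: sval_eq.
have -> : sval q = coprod_equiv (coprod_repr q).
  by rewrite /coprod_repr; case: cid.
have -> : sval r = coprod_equiv (coprod_repr r).
  by rewrite /coprod_repr; case: cid.
apply: funext => t; apply: propext; split=> h C f g; rewrite -(h C f g).
  exact: (esym (qr C f g)).
exact: (qr C f g).
Qed.

Definition coprod_subbase : set (set coprod_type) :=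
  [set S | exists C (f : top_hom A C) (g : top_hom B C) (O : set C),
    open O /\ S = coprod_ext f g @^-1` O].

HB.instance Definition _ :=
  isSubBaseTopological.Build coprod_type coprod_subbase id.

Lemma coprod_subbase_open (S : set coprod_type) : coprod_subbase S -> open S.
Proof.
move=> DS; exists [set S]; last by rewrite bigcup_set1.
move=> _ ->; exists [fset S]%fset.
  by move=> ?; rewrite inE inE => /eqP ->.
by rewrite predeqE => x; split=> [/(_ S)|Sx ?]; rewrite /= inE; [exact|move=> /eqP ->].
Qed.

Lemma coprod_ext_continuous C (f : top_hom A C) (g : top_hom B C) :
  continuous (coprod_ext f g).
Proof.
by apply/continuousP => O oO; apply: coprod_subbase_open; exists C, f, g, O.
Qed.

Lemma continuous_coprod_type (X : topologicalType) (h : X -> coprod_type) :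
  (forall C (f : top_hom A C) (g : top_hom B C),
    continuous (fun x => coprod_ext f g (h x))) -> continuous h.
Proof.
move=> hc x U; rewrite (@nbhsE coprod_type) => -[_ [[D sD <-] [S DS Sx]] sDU].
apply: filterS sDU _; apply: (@filterS _ _ _ (h @^-1` S)); first by move=> y ?; exists S.
have /sD [F sF IF] := DS; rewrite -IF preimage_bigcap.
apply: filter_bigI => O OF.
have /sF := OF; rewrite inE => -[C [f [g [V [oV OE]]]]].
have Ox : O (h x) by move: Sx; rewrite -IF; apply.
rewrite OE in Ox *; apply: (hc C f g x); exact: open_nbhs_nbhs.
Qed.

Definition coprod_interp (o : T) (q : 'I_(arity o) -> coprod_type) : coprod_type :=
  coprod_class (Op o (fun i => coprod_repr (q i))).

Lemma coprod_ext_interp C (f : top_hom A C) (g : top_hom B C) o q :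
  coprod_ext f g (@coprod_interp o q) = interp o (fun i => coprod_ext f g (q i)).
Proof. exact: coprod_extE. Qed.

Lemma coprod_algebraP : is_top_algebra coprod_interp.
Proof.
split=> [o|l r v lr].
  apply: continuous_coprod_type => C f g.
  have -> : (fun q => coprod_ext f g (@coprod_interp o q)) =
            (fun q => interp o (fun i => coprod_ext f g (q i))).
    by apply: funext => q; exact: coprod_ext_interp.
  move=> q; apply: (@continuous_comp {ptws 'I_(arity o) -> coprod_type}
    {ptws 'I_(arity o) -> C} C
    (fun (a : 'I_(arity o) -> coprod_type) i => coprod_ext f g (a i))).
    by apply: ptws_map_continuous; exact: coprod_ext_continuous.
  exact: (op_continuous (interpP C)).
apply: coprod_type_eq => C f g.
rewrite !(eval_hom (opB := @interp T C) (f := coprod_ext f g));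
  try exact: coprod_ext_interp.
exact: (op_eqn (interpP C)).
Qed.

Definition coprod_algebra : top_algebra T := TopAlgebra coprod_algebraP.

Lemma coprod_inj1P : is_top_hom (fun a => coprod_class (Var (inl a)) : coprod_algebra).
Proof.
split=> [|o a].
  apply: continuous_coprod_type => C f g.
  rewrite (_ : (fun _ => _) = f); first exact: (thfunP f).1.
  by apply: funext => a; rewrite coprod_extE.
apply: coprod_type_eq => C f g.
rewrite coprod_ext_interp coprod_extE /cocone_eval /= (thfunP f).2.
by congr interp; apply: funext => i; rewrite coprod_extE.
Qed.

Lemma coprod_inj2P : is_top_hom (fun b => coprod_class (Var (inr b)) : coprod_algebra).
Proof.
split=> [|o b].
  apply: continuous_coprod_type => C f g.
  rewrite (_ : (fun _ => _) = g); first exact: (thfunP g).1.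
  by apply: funext => b; rewrite coprod_extE.
apply: coprod_type_eq => C f g.
rewrite coprod_ext_interp coprod_extE /cocone_eval /= (thfunP g).2.
by congr interp; apply: funext => i; rewrite coprod_extE.
Qed.

Definition coprod_inj1 : top_hom A coprod_algebra := TopHom coprod_inj1P.
Definition coprod_inj2 : top_hom B coprod_algebra := TopHom coprod_inj2P.

Lemma coprod_copairP C (f : top_hom A C) (g : top_hom B C) :
  is_top_hom (coprod_ext f g : coprod_algebra -> C).
Proof.
by split=> [|o q]; [exact: coprod_ext_continuous|exact: coprod_ext_interp].
Qed.

Definition coprod_copair C (f : top_hom A C) (g : top_hom B C) :
  top_hom coprod_algebra C := TopHom (coprod_copairP f g).

Lemma coprod_copair1 C (f : top_hom A C) (g : top_hom B C) :
  top_comp (coprod_copair f g) coprod_inj1 = f.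
Proof. by apply: top_hom_eq => a; exact: coprod_extE. Qed.

Lemma coprod_copair2 C (f : top_hom A C) (g : top_hom B C) :
  top_comp (coprod_copair f g) coprod_inj2 = g.
Proof. by apply: top_hom_eq => a; exact: coprod_extE. Qed.

Lemma coprod_class_eval t : coprod_class t = eval coprod_interp
  (fun w => coprod_class (Var w)) t.
Proof.
apply: coprod_type_eq => C f g; rewrite coprod_extE.
rewrite (eval_hom (opB := @interp T C) (f := coprod_ext f g));
  try exact: coprod_ext_interp.
by congr eval; apply: funext => w; rewrite coprod_extE.
Qed.

Lemma coprod_copair_uniq C (h k : top_hom coprod_algebra C) :
  top_comp h coprod_inj1 = top_comp k coprod_inj1 ->
  top_comp h coprod_inj2 = top_comp k coprod_inj2 -> h = k.
Proof.
move=> hk1 hk2; apply: top_hom_eq => q.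
have -> : q = coprod_class (coprod_repr q).
  by apply: coprod_type_eq => D f g; rewrite coprod_extE.
rewrite coprod_class_eval.
rewrite (eval_hom (opB := @interp T C) (f := h)); last exact: (thfunP h).2.
rewrite (eval_hom (opB := @interp T C) (f := k)); last exact: (thfunP k).2.
congr eval; apply: funext => -[a|b].
  exact: (congr1 (fun u : top_hom A C => u a) hk1).
exact: (congr1 (fun u : top_hom B C => u b) hk2).
Qed.

End Coproduct.

Section TopPointed.
Variable T : pointed_theory.

Lemma Top_ker_inE (A B : Top T) (p : hom A B) :
  p ∘ (ker_incl p : hom (ker_algebra p : Top T) A) =
  top_comp (of_zero_algebra B) (to_zero_algebra (ker_algebra p)).
Proof. by apply: top_hom_eq => a; exact: ker_inclE. Qed.

Lemma Top_ker_lift_subproof (A B X : Top T) (p : hom A B) (f : hom X A) :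
  p ∘ f = top_comp (of_zero_algebra B) (to_zero_algebra X) ->
  forall x : X, p (f x) = zero_elt B.
Proof. by move=> pf0 x; exact: (congr1 (fun u : top_hom X B => u x) pf0). Qed.

Definition Top_ker_lift (A B : Top T) (p : hom A B) (X : Top T) (f : hom X A)
    (pf0 : p ∘ f = top_comp (of_zero_algebra B) (to_zero_algebra X)) :
    hom X (ker_algebra p : Top T) :=
  ker_factor (Top_ker_lift_subproof pf0).

Lemma Top_ker_liftE (A B : Top T) (p : hom A B) (X : Top T) (f : hom X A)
    (pf0 : p ∘ f = top_comp (of_zero_algebra B) (to_zero_algebra X)) :
  (ker_incl p : hom (ker_algebra p : Top T) A) ∘ Top_ker_lift pf0 = f.
Proof. exact: top_hom_eq. Qed.

Lemma Top_ker_in_mono (A B : Top T) (p : hom A B) (X : Top T)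
    (f g : hom X (ker_algebra p : Top T)) :
  (ker_incl p : hom (ker_algebra p : Top T) A) ∘ f =
  (ker_incl p : hom (ker_algebra p : Top T) A) ∘ g -> f = g.
Proof.
move=> fg; apply: top_hom_eq => x; apply: ker_incl_inj.
exact: (congr1 (fun u : top_hom X A => u x) fg).
Qed.

(* Top^T with its zero object, kernels and coproducts. *)
Definition TopP : pointed_category :=
  @PointedCategory (Top T) (zero_algebra T)
    (@to_zero_algebra T) (@of_zero_algebra T)
    (@to_zero_algebra_uniq T) (@of_zero_algebra_uniq T)
    (@ker_algebra T) (@ker_incl T) Top_ker_inE Top_ker_lift Top_ker_liftE
    Top_ker_in_mono
    (@coprod_algebra T) (@coprod_inj1 T) (@coprod_inj2 T) (@coprod_copair T)
    (@coprod_copair1 T) (@coprod_copair2 T) (@coprod_copair_uniq T).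

End TopPointed.

(* Main.v *)
Require Import Defs.
From mathcomp Require Import all_boot.
From mathcomp Require Import all_classical.
From mathcomp Require Import topology.

Set Implicit Arguments.
Unset Strict Implicit.
Unset Printing Implicit Defensive.

(**
Write r = [0,1] : X + B -> B for the retraction of the coproduct, and let
[deviation] send c to the element c - r(c) of the kernel of r.  Everything rests
on the continuous map

  [quot] : X + B -> X * B,   c |-> (xi (c - r(c)), r(c)).

It has the section s : (x, b) |-> x + b ([formal_sum]), because (x + b) - b = x and
xi is the identity on X.  The operations of the claim are those carried along
this retraction, w(a_1, .., a_n) := quot (w(s(a_1), .., s(a_n))), so the
question is whether quot is a homomorphism for them; if so, X * B inherits all
equations of the theory from X + B, and continuity is immediate since the
section and quot are continuous.

Associativity of xi answers it.  Put Y = flat X.  The two homomorphisms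
Y + B -> X + B given on Y by the inclusion and by xi, and by the identity on B,
induce on kernels the multiplication of the monad and the functorial image of
xi, which xi equalizes; hence quot equalizes the two homomorphisms
([quot_coequalizes]).  Any c_i in X + B is (c_i - r(c_i)) + r(c_i), that is, the
image under the first of them of an element d_i whose image under the second is
the formal sum of quot(c_i).  Evaluating at w(d_1, .., d_n) gives
quot (w(c_i)) = w(quot(c_i)) ([quot_interp]).

That the resulting functor from monad algebras to points is a quasi-inverse of
the comparison functor is then checked on elements.  The kernel of the
projection X * B -> B is X, with the action xi because [quot] is the
homomorphism X + B -> X * B induced by the inclusion of X and the section of B
([comparison_semidirect]).  Conversely a point (p : A -> B, t) with kernel K is
recovered from K by the homeomorphism K * B -> A, (k, b) |-> k + t(b), whose
inverse is a |-> (a - t(p(a)), p(a)) ([semidirect_comparison]).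
*)

(** * Continuity and homomorphisms *)

(* These names of the definitions are shadowed by the topology library. *)
Local Notation eval := Defs.eval.
Local Notation fmap := Defs.fmap.

Lemma eval_continuous (T : theory) (A : top_algebra T) (S : topologicalType)
    (W : Type) (v : S -> W -> A) (t : term T W) :
  (forall w, continuous (fun x => v x w)) ->
  continuous (fun x => eval (@interp T A) (v x) t).
Proof.
move=> vc; elim: t => [w|o ts IH] /=; first exact: vc.
move=> x; apply: (@continuous_comp S {ptws 'I_(arity o) -> A} A
  (fun x i => eval (@interp T A) (v x) (ts i)) (@interp T A o)).
  exact: ptws_continuous.
exact: (op_continuous (interpP A)).
Qed.

Lemma binop_continuous (T : theory) (t : term T 'I_2) (A : top_algebra T)
    (S : topologicalType) (f g : S -> A) :
  continuous f -> continuous g ->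
  continuous (fun x => binop t (@interp T A) (f x) (g x)).
Proof. by move=> fc gc; apply: eval_continuous => i; case: (i == ord0). Qed.

Lemma top_hom_continuous (T : theory) (A C : top_algebra T) (f : top_hom A C)
    (S : topologicalType) (g : S -> A) :
  continuous g -> continuous (fun x => f (g x)).
Proof. by move=> gc x; apply: continuous_comp; [exact: gc|exact: (thfunP f).1]. Qed.

Lemma top_hom_binop (T : theory) (t : term T 'I_2) (A C : top_algebra T)
    (f : top_hom A C) a b :
  f (binop t (@interp T A) a b) = binop t (@interp T C) (f a) (f b).
Proof.
rewrite /binop (eval_hom (opB := @interp T C) (f := f)); last exact: (thfunP f).2.
by congr eval; apply: funext => i; case: ifP.
Qed.

Lemma eval_binop (T : theory) (t : term T 'I_2) (A : top_algebra T) W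
    (v : W -> A) (l r : term T W) :
  eval (@interp T A) v (binop t (@Op T W) l r) =
  binop t (@interp T A) (eval (@interp T A) v l) (eval (@interp T A) v r).
Proof.
rewrite /binop (eval_hom (opB := @interp T A) (f := eval (@interp T A) v)) //.
by congr eval; apply: funext => i; case: ifP.
Qed.

Lemma eval_zero (T : pointed_theory) (A : top_algebra T) W (v : W -> A) :
  eval (@interp T A) v (zero_of (@Op T W)) = zero_elt A.
Proof.
rewrite /zero_of (eval_hom (opB := @interp T A) (f := eval (@interp T A) v)) //.
by congr eval; apply: funext; case.
Qed.

Lemma interp_continuous (T : theory) (A : top_algebra T) (S : topologicalType)
    (o : T) (f : S -> 'I_(arity o) -> A) :
  (forall i, continuous (fun x => f x i)) -> continuous (fun x => interp o (f x)).
Proof. exact: (@eval_continuous T A S _ f (Op o Var)). Qed.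

(** The inverse function of a bijective homomorphism preserves the operations
    automatically, so only its continuity is required. *)
Lemma top_iso (T : pointed_theory) (A C : top_algebra T) (f : top_hom A C)
    (g : C -> A) :
  continuous g -> cancel f g -> cancel g f -> @is_iso (TopP T) A C f.
Proof.
move=> gc fK gK.
have gP : is_top_hom g.
  split=> // o c; apply: (can_inj fK); rewrite gK (thfunP f).2.
  by congr interp; apply: funext => i; rewrite gK.
by exists (TopHom gP); split; apply: top_hom_eq => z /=; [exact: fK|exact: gK].
Qed.

(** * Isomorphisms of points, of monad algebras and of functors *)

Lemma point_iso (C : pointed_category) (B : C) (P Q : Pt B) (f : hom P Q) :
  is_iso (sval f) -> is_iso f.
Proof.
case: f => f [fp fs] /= [g [gf fg]].
have gP : compm (pproj P) g = pproj Q /\ compm g (psect Q) = psect P.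
  by split; [rewrite -fp -compmA fg compm1|rewrite -fs compmA gf comp1m].
by exists (exist _ g gP); split; apply: sval_eq.
Qed.

Lemma em_iso (C : category) (M : monad C) (X Y : em_category M) (f : hom X Y) :
  is_iso (sval f) -> is_iso f.
Proof.
case: f => f fP /= [g [gf fg]].
have gP : compm g (em_action Y) = compm (em_action X) (fmap M g).
  rewrite -[em_action Y]compm1 -(fmap1 M) -fg fmapM !compmA.
  by rewrite -(compmA g (em_action Y)) -fP !compmA gf comp1m.
by exists (exist _ g gP); split; apply: sval_eq.
Qed.

Lemma naturally_isomorphic_sym (C D : category) (F G : functor C D) :
  naturally_isomorphic F G -> naturally_isomorphic G F.
Proof.
move=> [t [tn tiso]]; pose u a := sval (cid (tiso a)).
have ut a : compm (u a) (t a) = idm _ := (svalP (cid (tiso a))).1.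
have tu a : compm (t a) (u a) = idm _ := (svalP (cid (tiso a))).2.
exists u; split=> [a b f|a]; last by exists (t a).
rewrite -[LHS]compm1 -(tu a) compmA -(compmA (u b)) -tn.
by rewrite compmA ut comp1m.
Qed.

(** * Identities of a right loop *)

Definition right_loop_axioms (T : pointed_theory) (plus minus : term T 'I_2) :=
  let x : term T 'I_2 := Var ord0 in
  let y : term T 'I_2 := Var ord_max in
  let o : term T 'I_2 := zero_of (@Op T 'I_2) in
  let add := binop plus (@Op T 'I_2) in
  let sub := binop minus (@Op T 'I_2) in
  [/\ provable (add x o) x,
      provable (add o x) x,
      provable (sub (add x y) y) x
    & provable (add (sub x y) y) x].

Section RightLoop.
Variables (T : pointed_theory) (plus minus : term T 'I_2).
Hypothesis plus_minusP : right_loop_axioms plus minus.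

Notation "x ⊕ y" := (binop plus (@interp T _) x y) (at level 50, left associativity).
Notation "x ⊖ y" := (binop minus (@interp T _) x y) (at level 50, left associativity).

Section Identities.
Variable A : top_algebra T.
Implicit Types x y : A.

Let val2 x y (i : 'I_2) : A := if i == ord0 then x else y.

Lemma add_zero x : x ⊕ zero_elt A = x.
Proof.
have [/(provable_sound (val2 x x))] := plus_minusP.
by rewrite eval_binop eval_zero.
Qed.

Lemma zero_add x : zero_elt A ⊕ x = x.
Proof.
have [_ /(provable_sound (val2 x x))] := plus_minusP.
by rewrite eval_binop eval_zero.
Qed.

Lemma addK x y : (x ⊕ y) ⊖ y = x.
Proof.
have [_ _ /(provable_sound (val2 x y))] := plus_minusP.
by rewrite !eval_binop.
Qed.

Lemma subK x y : (x ⊖ y) ⊕ y = x.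
Proof.
have [_ _ _ /(provable_sound (val2 x y))] := plus_minusP.
by rewrite !eval_binop.
Qed.

Lemma sub_self x : x ⊖ x = zero_elt A.
Proof. by rewrite -{1}[x]zero_add addK. Qed.

End Identities.

(** * The coproduct with B and the kernel of its retraction *)

Variable B : top_algebra T.

Let cop (X : top_algebra T) : top_algebra T := @coprod (TopP T) X B.
Let flatA (X : top_algebra T) : top_algebra T := @flat (TopP T) B X.
Let i1 (X : top_algebra T) : top_hom X (cop X) := @inj1 (TopP T) X B.
Let i2 (X : top_algebra T) : top_hom B (cop X) := @inj2 (TopP T) X B.
Let incl (X : top_algebra T) : top_hom (flatA X) (cop X) :=
  @flat_in (TopP T) B X.
Let copr (X C : top_algebra T) (f : top_hom X C) (g : top_hom B C) :
  top_hom (cop X) C := @copair (TopP T) X B C f g.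

Definition retr (X : top_algebra T) : top_hom (cop X) B :=
  copr (top_comp (of_zero_algebra B) (to_zero_algebra X)) (top_id B).

Section Deviation.
Variable X : top_algebra T.

Lemma top_copair1 (C : top_algebra T) (f : top_hom X C) (g : top_hom B C) x :
  copr f g (i1 X x) = f x.
Proof.
exact: (congr1 (fun h : top_hom X C => h x) (@copair1 (TopP T) X B C f g)).
Qed.

Lemma top_copair2 (C : top_algebra T) (f : top_hom X C) (g : top_hom B C) b :
  copr f g (i2 X b) = g b.
Proof.
exact: (congr1 (fun h : top_hom B C => h b) (@copair2 (TopP T) X B C f g)).
Qed.

Lemma top_copair_uniq (C : top_algebra T) (f g : top_hom (cop X) C) :
  (forall x, f (i1 X x) = g (i1 X x)) -> (forall b, f (i2 X b) = g (i2 X b)) ->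
  forall c, f c = g c.
Proof.
move=> fg1 fg2 c; congr (thfun _ c).
by apply: (@copair_uniq (TopP T)); exact: top_hom_eq.
Qed.

Lemma retr_inj1 x : retr X (i1 X x) = zero_elt B.
Proof. by rewrite /retr top_copair1. Qed.

Lemma retr_inj2 b : retr X (i2 X b) = b.
Proof. by rewrite /retr top_copair2. Qed.

Lemma retr_incl k : retr X (incl X k) = zero_elt B.
Proof. exact: ker_inclE. Qed.

Lemma incl_inj : injective (@incl X).
Proof. exact: (@ker_incl_inj T (cop X) B (retr X)). Qed.

Lemma retr_sub c : retr X (c ⊖ i2 X (retr X c)) = zero_elt B.
Proof. by rewrite top_hom_binop retr_inj2 sub_self. Qed.

(** The difference c - r(c): every c decomposes as its deviation plus an element
    of B, see [deviationK]. *)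
Definition deviation (c : cop X) : flatA X :=
  exist (fun x => x \in ker_set (retr X)) _ (mem_set (retr_sub c)).

Lemma incl_deviation c : incl X (deviation c) = c ⊖ i2 X (retr X c).
Proof. by []. Qed.

Lemma deviation_continuous : continuous deviation.
Proof.
apply: (@initial_continuousP _ _ _ (set_val : ker_set (retr X) -> cop X)).
apply: binop_continuous => [c|]; first exact: cvg_id.
by apply: top_hom_continuous; exact: (thfunP (retr X)).1.
Qed.

Lemma retrD k b : retr X (incl X k ⊕ i2 X b) = b.
Proof. by rewrite top_hom_binop retr_incl retr_inj2 zero_add. Qed.

Lemma deviationD k b : deviation (incl X k ⊕ i2 X b) = k.
Proof. by apply: incl_inj; rewrite incl_deviation retrD addK. Qed.

Lemma deviation_incl k : deviation (incl X k) = k.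
Proof. by rewrite -[incl X k]add_zero -(top_hom_zero (i2 X)) deviationD. Qed.

Lemma deviationK c : incl X (deviation c) ⊕ i2 X (retr X c) = c.
Proof. by rewrite incl_deviation subK. Qed.

End Deviation.

Section PointMorphism.
Variables (X Y : top_algebra T).
Variable h : @hom (@Pt (TopP T) B) (@F_ob (TopP T) B X) (@F_ob (TopP T) B Y).

Let hfun : top_hom (cop X) (cop Y) := sval h.

Lemma retr_natural c : retr Y (hfun c) = retr X c.
Proof. exact: (congr1 (fun f : top_hom (cop X) B => f c) (svalP h).1). Qed.

(** Both the multiplication of the monad at X and its action on a morphism are
    restrictions to kernels of a morphism of points h, so this one statement
    computes them on deviations. *)
Lemma deviation_natural c :
  deviation (hfun c) = (U_map h : top_hom _ _) (deviation c).
Proof.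
have hi2 b : hfun (i2 X b) = i2 Y b.
  exact: (congr1 (fun f : top_hom B (cop Y) => f b) (svalP h).2).
apply: incl_inj; transitivity (hfun (incl X (deviation c))); last by [].
by rewrite !incl_deviation top_hom_binop retr_natural hi2.
Qed.

End PointMorphism.

Let eta (X : top_algebra T) : top_hom X (flatA X) :=
  munit (T_monad (B : TopP T)) X.

Lemma incl_eta X x : incl X (eta X x) = i1 X x.
Proof. by []. Qed.

(** * The algebra structure on the product X * B *)

Section Semidirect.
Variables (X : top_algebra T) (xi : top_hom (flatA X) X).
Hypothesis xiP : @is_em_algebra (TopP T) (T_monad (B : TopP T)) X xi.

Lemma action_eta x : xi (eta X x) = x.
Proof. exact: (congr1 (fun f : top_hom X X => f x) xiP.1). Qed.

(** The quotient map from X + B onto the semidirect product.  It has the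
    continuous section [formal_sum], which is why the product topology is the
    quotient topology here. *)
Definition quot (c : cop X) : (X * B)%type := (xi (deviation c), retr X c).

Definition formal_sum (a : (X * B)%type) : cop X := i1 X a.1 ⊕ i2 X a.2.

Lemma quot_continuous : continuous quot.
Proof.
have xic : continuous (fun c => xi (deviation c)).
  by apply: top_hom_continuous; exact: deviation_continuous.
by move=> c; exact: (cvg_pair (xic c) ((thfunP (retr X)).1 c)).
Qed.

Lemma formal_sumK : cancel formal_sum quot.
Proof.
by move=> [x b]; rewrite /quot /formal_sum -incl_eta deviationD retrD action_eta.
Qed.

(* The parallel pair from flat X + B to X + B: the identity on B, and on flat X
   the inclusion, respectively xi. *)
Let flat2 : top_hom (cop (flatA X)) (cop X) :=
  sval (FU_counit (@F_functor (TopP T) B X)).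
Let flat_xi : top_hom (cop (flatA X)) (cop X) :=
  sval (@F_map (TopP T) B _ _ xi).

(** On kernels the pair restricts to the multiplication of the monad and to the
    image of xi, which become equal after xi by associativity of the action. *)
Lemma quot_coequalizes d : quot (flat2 d) = quot (flat_xi d).
Proof.
rewrite /quot /flat2 /flat_xi !retr_natural !deviation_natural; congr pair.
exact: (congr1 (fun f : top_hom (flatA (flatA X)) X => f (deviation d)) xiP.2).
Qed.

Definition semidirect_interp (w : T) (a : 'I_(arity w) -> (X * B)%type) :
  (X * B)%type := quot (interp w (fun i => formal_sum (a i))).

(** Lift c_i along the first map of the pair to d_i = (c_i - r(c_i)) + r(c_i),
    computed in flat X + B.  The second map sends d_i to the formal sum of
    quot (c_i), and both maps commute with w. *)
Lemma quot_interp w c :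
  quot (interp w c) = @semidirect_interp w (fun i => quot (c i)).
Proof.
pose d i : cop (flatA X) := i1 _ (deviation (c i)) ⊕ i2 _ (retr X (c i)).
have flat2_1 k : flat2 (i1 _ k) = incl X k by exact: top_copair1.
have flat2_2 b : flat2 (i2 _ b) = i2 X b by exact: top_copair2.
have flat_xi1 k : flat_xi (i1 _ k) = i1 X (xi k) by exact: top_copair1.
have flat_xi2 b : flat_xi (i2 _ b) = i2 X b by exact: top_copair2.
have flat2d i : flat2 (d i) = c i.
  by rewrite top_hom_binop flat2_1 flat2_2 deviationK.
have flat_xid i : flat_xi (d i) = formal_sum (quot (c i)).
  by rewrite top_hom_binop flat_xi1 flat_xi2.
have := quot_coequalizes (interp w d).
rewrite (thfunP flat2).2 (thfunP flat_xi).2 /semidirect_interp.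
rewrite (_ : (fun i => flat2 (d i)) = c); last exact: funext.
rewrite (_ : (fun i => flat_xi (d i)) = (fun i => formal_sum (quot (c i)))) //.
exact: funext.
Qed.

(** Evaluating a term in X * B amounts to evaluating it in X + B and applying the
    surjection [quot], so the equations valid in X + B persist. *)
Lemma semidirectP : is_top_algebra semidirect_interp.
Proof.
split=> [w|l r v lr].
  move=> a; apply: (@continuous_comp {ptws 'I_(arity w) -> (X * B)%type} (cop X)
    (X * B)%type (fun a => interp w (fun i => formal_sum (a i))) quot);
    last exact: quot_continuous.
  move: a; apply: interp_continuous => i; apply: binop_continuous.
    apply: top_hom_continuous => a.
    apply: (@continuous_comp {ptws 'I_(arity w) -> (X * B)%type} (X * B)%type X
      (fun a => a i) fst); first exact: ptws_proj_continuous.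
    exact: cvg_fst.
  apply: top_hom_continuous => a.
  apply: (@continuous_comp {ptws 'I_(arity w) -> (X * B)%type} (X * B)%type B
    (fun a => a i) snd); first exact: ptws_proj_continuous.
  exact: cvg_snd.
have quot_eval t : eval semidirect_interp v t =
    quot (eval (@interp T (cop X)) (fun w => formal_sum (v w)) t).
  rewrite (eval_hom (opB := semidirect_interp) (f := quot)); last exact: quot_interp.
  by congr eval; apply: funext => w; rewrite formal_sumK.
by rewrite !quot_eval (op_eqn (interpP (cop X)) _ lr).
Qed.

Definition semidirect_algebra : top_algebra T := TopAlgebra semidirectP.

Lemma quotP : is_top_hom (quot : cop X -> semidirect_algebra).
Proof. by split; [exact: quot_continuous|exact: quot_interp]. Qed.

Definition quot_hom : top_hom (cop X) semidirect_algebra := TopHom quotP.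

Lemma retr_formal_sum a : retr X (formal_sum a) = a.2.
Proof. by rewrite /formal_sum -incl_eta retrD. Qed.

Lemma semidirect_projP : is_top_hom (fun a : semidirect_algebra => a.2).
Proof.
split=> [a|w a]; first exact: cvg_snd.
transitivity (interp w (fun i => retr X (formal_sum (a i)))).
  exact: (thfunP (retr X)).2.
by congr interp; apply: funext => i; exact: retr_formal_sum.
Qed.

Definition semidirect_proj : top_hom semidirect_algebra B :=
  TopHom semidirect_projP.

Lemma quot_inj1 x : quot (i1 X x) = (x, zero_elt B).
Proof. by rewrite /quot retr_inj1 -incl_eta deviation_incl action_eta. Qed.

Lemma quot_inj2 b : quot (i2 X b) = (zero_elt X, b).
Proof.
rewrite -[RHS]formal_sumK; congr quot.
transitivity (i1 X (zero_elt X) ⊕ i2 X b); last by [].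
by rewrite top_hom_zero zero_add.
Qed.

Lemma quot_incl k : quot (incl X k) = (xi k, zero_elt B).
Proof. by rewrite /quot deviation_incl retr_incl. Qed.

Definition semidirect_fiber : top_hom X semidirect_algebra :=
  top_comp quot_hom (i1 X).

Lemma semidirect_fiberE x : semidirect_fiber x = (x, zero_elt B).
Proof. exact: quot_inj1. Qed.

Definition semidirect_sect : top_hom B semidirect_algebra :=
  top_comp quot_hom (i2 X).

Lemma semidirect_sectE b : semidirect_sect b = (zero_elt X, b).
Proof. exact: quot_inj2. Qed.

Lemma semidirect_sectK :
  @compm (TopP T) B semidirect_algebra B semidirect_proj semidirect_sect =
  @idm (TopP T) B.
Proof. by apply: top_hom_eq => b; exact: retr_inj2. Qed.

Definition semidirect_point : @Pt (TopP T) B := Point semidirect_sectK.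

End Semidirect.

(** * The semidirect product as a functor *)

Let M : monad (TopP T) := T_monad (B : TopP T).
Let act (X : em_category M) : top_hom (flatA (em_carrier X)) (em_carrier X) :=
  em_action X.

Section SemidirectMap.
Variables (X Y : em_category M) (f : hom X Y).

Let ffun : top_hom (em_carrier X) (em_carrier Y) := sval f.
Let Ff : top_hom (cop (em_carrier X)) (cop (em_carrier Y)) :=
  sval (@F_map (TopP T) B _ _ (sval f)).

Definition semidirect_map (a : (em_carrier X : top_algebra T) * B) :
  (em_carrier Y : top_algebra T) * B := (ffun a.1, a.2).

(** This is where the compatibility of f with the two actions enters. *)
Lemma semidirect_map_quot c :
  semidirect_map (quot (act X) c) = quot (act Y) (Ff c).
Proof.
rewrite /quot /Ff retr_natural deviation_natural; congr pair.
exact: (congr1 (fun h : top_hom (flatA (em_carrier X)) (em_carrier Y) =>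
  h (deviation c)) (svalP f)).
Qed.

Lemma semidirect_map_formal_sum a : Ff (formal_sum a) = formal_sum (semidirect_map a).
Proof.
rewrite top_hom_binop; congr (binop plus _).
  exact: top_copair1.
exact: top_copair2.
Qed.

Lemma semidirect_mapP : is_top_hom (semidirect_map :
  semidirect_algebra (em_actionP X) -> semidirect_algebra (em_actionP Y)).
Proof.
split=> [a|w a].
  apply: (cvg_pair (f := fun a => ffun a.1)); last exact: cvg_snd.
  have fst_c : continuous (fst : semidirect_algebra (em_actionP X) -> _).
    by move=> ?; exact: cvg_fst.
  exact: (top_hom_continuous (f := ffun) fst_c).
rewrite /= [LHS]semidirect_map_quot; congr (quot (act Y) _).
rewrite (thfunP Ff).2; congr interp; apply: funext => i.
exact: semidirect_map_formal_sum.
Qed.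

Definition semidirect_map_hom : top_hom (semidirect_algebra (em_actionP X))
  (semidirect_algebra (em_actionP Y)) := TopHom semidirect_mapP.

Lemma semidirect_map_point :
  @compm (TopP T) _ _ _ (pproj (semidirect_point (em_actionP Y)))
    semidirect_map_hom = pproj (semidirect_point (em_actionP X)) /\
  @compm (TopP T) _ _ _ semidirect_map_hom
    (psect (semidirect_point (em_actionP X))) =
  psect (semidirect_point (em_actionP Y)).
Proof.
split; apply: top_hom_eq => // b.
transitivity (semidirect_map (zero_elt (em_carrier X), b)).
  by congr semidirect_map; exact: semidirect_sectE.
rewrite /semidirect_map [(_, _).1]/= top_hom_zero.
by rewrite -(semidirect_sectE (em_actionP Y)).
Qed.

Definition semidirect_fmap : @hom (@Pt (TopP T) B)
    (semidirect_point (em_actionP X)) (semidirect_point (em_actionP Y)) :=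
  exist _ (semidirect_map_hom : @hom (TopP T) (pdom (semidirect_point _)) _)
    semidirect_map_point.

End SemidirectMap.

Lemma semidirect_fmap1 (X : em_category M) :
  semidirect_fmap (idm X) = idm (semidirect_point (em_actionP X) : Pt _).
Proof. by apply: sval_eq; apply: top_hom_eq => -[x b]. Qed.

Lemma semidirect_fmapM (X Y Z : em_category M) (g : hom Y Z) (f : hom X Y) :
  semidirect_fmap (compm g f) = compm (semidirect_fmap g) (semidirect_fmap f).
Proof. by apply: sval_eq; apply: top_hom_eq => -[x b]. Qed.

Definition semidirect_functor : functor (em_category M) (@Pt (TopP T) B) :=
  @Functor (em_category M) (@Pt (TopP T) B)
    (fun X => semidirect_point (em_actionP X))
    semidirect_fmap semidirect_fmap1 semidirect_fmapM.

(** * Recovering a monad algebra from its semidirect product *)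

Let J : functor (@Pt (TopP T) B) (em_category M) := J_functor (B : TopP T).

Section KernelOfSemidirect.
Variable X : em_category M.

Let SX := semidirect_algebra (em_actionP X).
Let fiber : top_hom (em_carrier X) SX := semidirect_fiber (em_actionP X).

Lemma fiber_proj x :
  semidirect_proj (em_actionP X) (fiber x) = zero_elt B.
Proof. exact: retr_inj1. Qed.

Definition fiber_ker : top_hom (em_carrier X)
  (ker_algebra (semidirect_proj (em_actionP X))) := ker_factor fiber_proj.

(** The action on the kernel of the projection is the restriction of the
    homomorphism X + B -> X * B induced by the fiber inclusion and the section.
    That homomorphism is [quot], which on flat X takes the value (xi k, 0). *)
Lemma fiber_ker_em :
  @compm (TopP T) _ _ _ fiber_ker (em_action X) =
  @compm (TopP T) _ _ _ (em_action (J (semidirect_functor X)))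
    (fmap M (fiber_ker : @hom (TopP T) _ _)).
Proof.
apply: top_hom_eq => k; apply: ker_incl_inj.
transitivity (quot (act X) (incl _ k)).
  by rewrite quot_incl; exact: (semidirect_fiberE (em_actionP X)).
(* The homomorphism from X + B induced by the fiber inclusion and the section *)
pose ext : top_hom (cop (em_carrier X)) SX :=
  @compm (TopP T) _ _ _ (sval (FU_counit (semidirect_functor X)))
   (sval (@F_map (TopP T) B _ _ fiber_ker)).
transitivity (ext (incl _ k)); last by [].
apply: (top_copair_uniq (f := quot_hom (em_actionP X))) => [x|b].
  transitivity (sval (FU_counit (semidirect_functor X)) (i1 _ (fiber_ker x)) : SX).
    by rewrite [RHS]top_copair1.
  by congr (thfun _ _); rewrite [RHS]top_copair1.
transitivity (sval (FU_counit (semidirect_functor X)) (i2 _ b) : SX).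
  by rewrite [RHS]top_copair2.
by congr (thfun _ _); rewrite [RHS]top_copair2.
Qed.

Definition fiber_em : hom X (J (semidirect_functor X)) :=
  exist _ (fiber_ker : @hom (TopP T) _ _) fiber_ker_em.

Lemma fiber_em_iso : is_iso fiber_em.
Proof.
apply: em_iso.
apply: (@top_iso _ _ _ fiber_ker (fun k => (ker_incl _ k).1)).
- move=> k; apply: (@continuous_comp
    (ker_algebra (semidirect_proj (em_actionP X))) (em_carrier X * B)%type
    (em_carrier X : top_algebra T) (ker_incl _) fst).
    exact: (thfunP (ker_incl _)).1.
  exact: cvg_fst.
- by move=> x; rewrite [ker_incl _ _](semidirect_fiberE (em_actionP X)).
move=> k; apply: ker_incl_inj; rewrite [LHS](semidirect_fiberE (em_actionP X)).
by rewrite -(ker_inclE k) -surjective_pairing.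
Qed.

End KernelOfSemidirect.

Lemma comparison_semidirect :
  naturally_isomorphic (comp_functor J semidirect_functor) (id_functor _).
Proof.
apply: naturally_isomorphic_sym; exists fiber_em.
split; last exact: fiber_em_iso.
move=> X Y f; apply: sval_eq; apply: top_hom_eq => x; apply: ker_incl_inj.
rewrite [LHS](semidirect_fiberE (em_actionP Y)).
transitivity (semidirect_map f (x, zero_elt B)); first by [].
by congr semidirect_map; rewrite -(semidirect_fiberE (em_actionP X)).
Qed.

(** * Recovering a point from its kernel *)

Section PointDecomposition.
Variable P : @Pt (TopP T) B.

Let A : top_algebra T := pdom P.
Let p : top_hom A B := pproj P.
Let s : top_hom B A := psect P.
Let K : top_algebra T := ker_algebra p.
Let counit : top_hom (cop K) A := sval (FU_counit P).

Lemma proj_sect b : p (s b) = b.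
Proof. exact: (congr1 (fun f : top_hom B B => f b) (psectK P)). Qed.

Definition recompose (a : K * B) : A := ker_incl p a.1 ⊕ s a.2.

(** The canonical homomorphism K + B -> A factors through [quot]; as it is a
    homomorphism, so is the second factor [recompose], by [recomposeP]. *)
Lemma recompose_quot c : recompose (quot (act (J P)) c) = counit c.
Proof.
rewrite -[in RHS](deviationK c) top_hom_binop; congr (binop plus _).
by rewrite [RHS]top_copair2.
Qed.

Lemma counit_formal_sum a : counit (formal_sum a) = recompose a.
Proof.
rewrite top_hom_binop; congr (binop plus _).
  exact: top_copair1.
exact: top_copair2.
Qed.

Lemma recomposeP :
  is_top_hom (recompose : semidirect_algebra (em_actionP (J P)) -> A).
Proof.
split=> [|w a].
  apply: binop_continuous; apply: top_hom_continuous => a.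
    exact: cvg_fst.
  exact: cvg_snd.
rewrite [LHS]recompose_quot (thfunP counit).2; congr interp.
by apply: funext => i; exact: counit_formal_sum.
Qed.

Definition recompose_hom : top_hom (semidirect_algebra (em_actionP (J P))) A :=
  TopHom recomposeP.

Lemma recompose_point :
  @compm (TopP T) _ _ _ (pproj P) recompose_hom =
    pproj (semidirect_functor (J P)) /\
  @compm (TopP T) _ _ _ recompose_hom (psect (semidirect_functor (J P))) =
    psect P.
Proof.
split; apply: top_hom_eq => a.
  transitivity (p (recompose a)); first by [].
  by rewrite top_hom_binop ker_inclE proj_sect zero_add.
transitivity (counit (i2 K a)); first exact: recompose_quot.
exact: top_copair2.
Qed.

Definition recompose_pt : hom (semidirect_functor (J P)) P :=
  exist _ (recompose_hom : @hom (TopP T) (pdom (semidirect_functor (J P))) _)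
    recompose_point.

Lemma proj_sub a : p (a ⊖ s (p a)) = zero_elt B.
Proof. by rewrite top_hom_binop proj_sect sub_self. Qed.

Definition decompose (a : A) : K * B :=
  (exist (fun x => x \in ker_set p) _ (mem_set (proj_sub a)), p a).

Lemma decompose_continuous : continuous decompose.
Proof.
have dc : continuous (fun a => (decompose a).1).
  apply: (@initial_continuousP _ _ _ (set_val : ker_set p -> A)).
  change (continuous (fun a => a ⊖ s (p a))).
  apply: binop_continuous => [a|]; first exact: cvg_id.
  by apply: top_hom_continuous; exact: (thfunP p).1.
by move=> a; exact: (cvg_pair (dc a) ((thfunP p).1 a)).
Qed.

Lemma recomposeK : cancel recompose decompose.
Proof.
move=> [k b]; have pr : p (recompose (k, b)) = b.
  by rewrite top_hom_binop ker_inclE proj_sect zero_add.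
congr pair; last exact: pr.
apply: ker_incl_inj.
transitivity (recompose (k, b) ⊖ s (p (recompose (k, b)))); first by [].
by rewrite pr addK.
Qed.

Lemma decomposeK : cancel decompose recompose.
Proof. by move=> a; exact: subK. Qed.

Lemma recompose_pt_iso : is_iso recompose_pt.
Proof.
apply: point_iso; apply: (@top_iso _ _ _ recompose_hom decompose).
- exact: decompose_continuous.
- exact: recomposeK.
- exact: decomposeK.
Qed.

End PointDecomposition.

Lemma semidirect_comparison :
  naturally_isomorphic (comp_functor semidirect_functor J) (id_functor _).
Proof.
exists recompose_pt; split; last exact: recompose_pt_iso.
move=> P Q f; apply: sval_eq; apply: top_hom_eq => a.
pose g : top_hom (pdom P) (pdom Q) := sval f.
transitivity (g (recompose a)); last by [].
rewrite top_hom_binop; congr (binop plus _).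
exact: (esym (congr1 (fun h : top_hom B (pdom Q) => h a.2) (svalP f).2)).
Qed.

Lemma semidirect_pointP (X : em_category M) :
  is_semidirect_product X (semidirect_point (em_actionP X)).
Proof.
exists semidirect_functor; split.
  by split; [exact: semidirect_comparison|exact: comparison_semidirect].
by exists (idm _), (idm _); rewrite compm1.
Qed.

End RightLoop.

Theorem mainTheorem1 (T : pointed_theory) (plus minus : term T 'I_2)
    (plus_minus_axioms :
      let x : term T 'I_2 := Var ord0 in
      let y : term T 'I_2 := Var ord_max in
      let o : term T 'I_2 := zero_of (@Op T 'I_2) in
      let add := binop plus (@Op T 'I_2) in
      let sub := binop minus (@Op T 'I_2) in
      [/\ provable (add x o) x,
          provable (add o x) x,
          provable (sub (add x y) y) x
        & provable (add (sub x y) y) x])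
    (B X : top_algebra T)
    (xi : @hom (TopP T) (@flat (TopP T) B X) X)
    (xiP : @is_em_algebra (TopP T) (T_monad (B : TopP T)) X xi) :
  exists op : forall w : T, ('I_(arity w) -> (X * B)%type) -> (X * B)%type,
    (forall (w : T) (x : 'I_(arity w) -> X) (b : 'I_(arity w) -> B),
      let XB : top_algebra T := @coprod (TopP T) X B in
      let i1 : top_hom X XB := @inj1 (TopP T) X B in
      let i2 : top_hom B XB := @inj2 (TopP T) X B in
      let incl : top_hom (@flat (TopP T) B X) XB := @flat_in (TopP T) B X in
      let add := binop plus (@interp T XB) in
      let sub := binop minus (@interp T XB) in
      exists k : (@flat (TopP T) B X : top_algebra T),
        incl k = sub (interp w (fun i => add (i1 (x i)) (i2 (b i))))
                     (interp w (fun i => i2 (b i))) /\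
        op w (fun i => (x i, b i)) = ((xi : top_hom _ _) k, interp w b)) /\
    exists opP : is_top_algebra op,
      let A : top_algebra T := TopAlgebra opP in
      exists (p : top_hom A B) (s : top_hom B A)
             (ps : @compm (TopP T) B A B p s = @idm (TopP T) B),
        (forall a : A, p a = a.2) /\
        (forall b : B, s b = (zero_elt X, b)) /\
        @is_semidirect_product (TopP T) B (EMAlgebra xiP) (Point ps).
Proof.
exists (semidirect_interp plus_minus_axioms xi).
split=> [w x b XB i1 i2 incl add sub|].
  pose c : XB := interp w (fun i => add (i1 (x i)) (i2 (b i))).
  have rc : retr B X c = interp w b.
    rewrite (thfunP (retr B X)).2; congr interp; apply: funext => i.
    exact: (retr_formal_sum plus_minus_axioms (x i, b i)).
  exists (deviation plus_minus_axioms c); split; last by rewrite -rc.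
  rewrite [LHS]incl_deviation rc; congr (binop minus _).
  exact: (thfunP i2).2.
exists (semidirectP plus_minus_axioms xiP).
exists (semidirect_proj plus_minus_axioms xiP).
exists (semidirect_sect plus_minus_axioms xiP).
exists (semidirect_sectK plus_minus_axioms xiP).
split=> //; split; first exact: semidirect_sectE.
exact: (semidirect_pointP plus_minus_axioms (EMAlgebra xiP)).
Qed.
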